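(* Let $s\ge 2$ be an integer and let $\varepsilon>0$. Then there exists $n_0$ such that for every integer $n\ge n_0$ the following holds. If $G$ is a tripartite graph with three vertex classes each of size $n$ and minimum degree $$\delta(G)\ \ge\ n+(1+\varepsilon)(s-1)^{1/(3s^{2})}\,n^{1-1/(3s^{2})},$$ then $G$ contains a copy of $K_3(s)$.
   Context: A tripartite graph here has its vertex set partitioned into three classes $V_1,V_2,V_3$ with no edges inside any class. $K_3(s)$ denotes the complete tripartite graph with three classes of size $s$ each. ''$G$ contains a copy of $H$'' means $G$ has a subgraph isomorphic to $H$. *)

(* Defs.v *)
From mathcomp Require Import all_boot all_order all_algebra.
From mathcomp Require Import reals exp.

Set Implicit Arguments.
Unset Strict Implicit.
Unset Printing Implicit Defensive.

Record sgraph := SGraph {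
  vertex :> finType;
  adj : rel vertex;
  adj_sym : symmetric adj;
  adj_irr : irreflexive adj }.

Definition degree (G : sgraph) (x : G) : nat := #|[set y | adj x y]|.

(* The default value #|G| never matters when G has a vertex, since every
   degree is smaller than #|G|. *)
Definition min_degree (G : sgraph) : nat := \big[minn/#|G|]_(x : G) degree x.

(* Classes may a priori be empty; their size is prescribed separately. *)
Definition tripartition (G : sgraph) (V : 'I_3 -> {set G}) : Prop :=
  [/\ \bigcup_i V i = [set: G],
      forall i j, i != j -> [disjoint V i & V j] &
      forall i x y, x \in V i -> y \in V i -> ~~ adj x y].

(* W and F are the vertex set and the edge relation of a (not necessarily
   induced) subgraph of G. *)
Definition is_subgraph (G : sgraph) (W : {set G}) (F : rel G) : Prop :=
  symmetric F /\ forall x y, F x y -> [/\ x \in W, y \in W & adj x y].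

Definition isomorphic_to (H G : sgraph) (W : {set G}) (F : rel G) : Prop :=
  exists f : H -> G,
    [/\ injective f, f @: [set: H] = W & forall u v, F (f u) (f v) = adj u v].

Definition contains_copy (G H : sgraph) : Prop :=
  exists (W : {set G}) (F : rel G), is_subgraph W F /\ isomorphic_to H W F.

Section CompleteTripartite.
Variable s : nat.

Definition K3_adj : rel ('I_3 * 'I_s)%type := fun u v => u.1 != v.1.

Lemma K3_adj_sym : symmetric K3_adj.
Proof. by move=> u v; rewrite /K3_adj eq_sym. Qed.

Lemma K3_adj_irr : irreflexive K3_adj.
Proof. by move=> u; rewrite /K3_adj eqxx. Qed.

Definition K3 : sgraph := SGraph K3_adj_sym K3_adj_irr.
End CompleteTripartite.

(* Main.v *)
Require Import Defs.
From mathcomp Require Import all_boot all_order all_algebra.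
From mathcomp Require Import zify lra.
From mathcomp Require Import boolp reals exp.

Set Implicit Arguments.
Unset Strict Implicit.
Unset Printing Implicit Defensive.

Import Order.TTheory GRing.Theory Num.Theory.

(* A tripartite graph with minimum degree at least [n + t] has at least [t ^ 3]
   triangles (Bollobás, Erdős and Szemerédi).  View the triangles as the edges
   of a 3-partite 3-graph.  If there is no K_3(s), two rounds of
   Kővári–Sós–Turán double counting bound their number by
   [(1 + o(1)) (s - 1)^(1/s^2) n^(3 - 1/s^2)], whereas the degree hypothesis
   gives [(1 + eps)^3] times this quantity. *)

(** * Power means and Kővári-Sós-Turán double counting *)

(** Over the integers, right side minus left side is [(a - b) * (a ^ s - b ^ s)], whose factors
    never have opposite signs. *)
Lemma mul_expn_rearrangement (a b s : nat) :
  a * b ^ s + b * a ^ s <= a ^ s.+1 + b ^ s.+1.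
Proof.
wlog le_ab : a b / a <= b.
  move=> W; case: (leqP a b) => [/W//|/ltnW/W].
  by rewrite addnC [in X in _ <= X]addnC.
have le_s : a ^ s <= b ^ s by case: s => // s; rewrite leq_exp2r.
rewrite !expnS.
by move: (a ^ s) (b ^ s) le_s => p q; nia.
Qed.

(** Induction on [s]: each step costs a factor [#|B|] by Chebyshev's sum inequality for the
    similarly ordered [F] and [F ^ s.+1]. *)
Lemma power_mean (I : finType) (B : {set I}) (F : I -> nat) (s : nat) :
  (\sum_(b in B) F b) ^ s.+1 <= #|B| ^ s * \sum_(b in B) F b ^ s.+1.
Proof.
elim: s => [|s IHs].
  by rewrite expn1 expn0 mul1n; apply: leq_sum => b _; rewrite expn1.
have cheb : (\sum_(b in B) F b) * (\sum_(b in B) F b ^ s.+1)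
            <= #|B| * \sum_(b in B) F b ^ s.+2.
  (* Doubling turns both sides into sums over ordered pairs, compared termwise by rearrangement. *)
  rewrite -leq_double -!addnn {2}mulnC !big_distrlr /= -big_split /=.
  rewrite -[in X in _ <= X]sum_nat_const.
  under eq_bigr do rewrite -big_split /=.
  apply: (@leq_trans
    (\sum_(a in B) \sum_(b in B) (F a ^ s.+2 + F b ^ s.+2))).
    apply: leq_sum => a _; apply: leq_sum => b _.
    by rewrite [F a ^ s.+1 * _]mulnC; apply: mul_expn_rearrangement.
  under eq_bigr do rewrite big_split /= sum_nat_const.
  by rewrite big_split /= -big_distrr /= !sum_nat_const.
rewrite expnS; apply: leq_trans (leq_mul (leqnn _) IHs) _.
by rewrite mulnCA expnSr -mulnA leq_mul2l cheb orbT.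
Qed.

(** Each factor [d, ..., d - s] of the falling factorial is at least [d - s]; for [d <= s] the left
    side is zero. *)
Lemma expn_sub_le_ffact (d s : nat) : (d - s) ^ s.+1 <= d ^_ s.+1.
Proof.
elim: s d => [|s IHs] d; first by rewrite subn0 expn1 ffactn1.
case: d => [|d]; first by rewrite sub0n exp0n.
rewrite subSS ffactSS expnS leq_mul //; lia.
Qed.

Lemma sum_nat_mem_card (T : finType) (A : {set T}) (P : pred T) :
  \sum_(x in A) (P x : nat) = #|[set x in A | P x]|.
Proof.
by rewrite -sum1dep_card [RHS]big_mkcondr.
Qed.

(* One Kővári–Sós–Turán step: double counting pairs [(S, b)] with [S] an
   [s.+1]-subset of [A] lying in the neighbourhood of [b]. *)
Lemma kovari_sos_turan_step (X Y : finType) (A : {set X}) (B : {set Y})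
    (r : X -> Y -> bool) (s m : nat) :
  (forall S : {set X}, S \subset A -> #|S| = s.+1 ->
     #|[set b in B | [forall x in S, r x b]]| <= m) ->
  (\sum_(b in B) \sum_(a in A) r a b - #|B| * s) ^ s.+1
    <= #|B| ^ s * (m * #|A| ^ s.+1).
Proof.
move=> few; pose d b := #|[set a in A | r a b]|.
apply: (@leq_trans ((\sum_(b in B) (d b - s)) ^ s.+1)).
  rewrite leq_exp2r // leq_subLR -sum_nat_const -big_split /=.
  apply: leq_sum => b _; rewrite sum_nat_mem_card -/(d b); lia.
apply: leq_trans (power_mean _ _ _) _; rewrite leq_mul2l; apply/orP; right.
apply: (@leq_trans (\sum_(b in B) d b ^_ s.+1)).
  by apply: leq_sum => b _; apply: expn_sub_le_ffact.
under eq_bigr do rewrite -bin_ffact.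
rewrite -big_distrl /=.
pose D := [set S : {set X} | S \subset A & #|S| == s.+1].
have -> : \sum_(b in B) 'C(d b, s.+1)
        = \sum_(S in D) #|[set b in B | [forall x in S, r x b]]|.
  transitivity (\sum_(b in B) \sum_(S in D) ([forall x in S, r x b] : nat)).
    apply: eq_bigr => b _; rewrite sum_nat_mem_card -cards_draws.
    apply: eq_card => S; rewrite !inE.
    rewrite [RHS]andbAC; congr (_ && _).
    apply/subsetP/andP => [sub|[/subsetP subA /forall_inP h] x xS].
      split; first by apply/subsetP => x /sub; rewrite inE => /andP[].
      by apply/forall_inP => x /sub; rewrite inE => /andP[].
    by rewrite inE subA // h.
  by rewrite exchange_big; apply: eq_bigr => S _; rewrite sum_nat_mem_card.
apply: (@leq_trans ((\sum_(S in D) m) * s.+1`!)).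
  rewrite leq_mul2r; apply/orP; right; apply: leq_sum => S.
  by rewrite inE => /andP[sSA /eqP cS]; apply: few.
rewrite sum_nat_const cards_draws mulnAC bin_ffact mulnC leq_mul2l.
apply/orP; right; rewrite ffact_prod -[X in _ ^ X]card_ord -prod_nat_const.
by apply: leq_prod => i _; apply: leq_subr.
Qed.

(** * Subsets, class indices and minimum degree *)

Lemma subset_of_card (T : finType) (A : {set T}) (t : nat) :
  t <= #|A| -> exists2 S : {set T}, S \subset A & #|S| = t.
Proof.
move=> tA; have : 0 < #|[set S : {set T} | S \subset A & #|S| == t]|.
  by rewrite cards_draws bin_gt0.
by case/card_gt0P => S; rewrite inE => /andP[? /eqP]; exists S.
Qed.

Lemma ord3_cases (i j k a : 'I_3) :
  i != j -> j != k -> i != k -> [|| a == i, a == j | a == k].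
Proof.
rewrite -!(inj_eq val_inj) /=.
move: (ltn_ord i) (ltn_ord j) (ltn_ord k) (ltn_ord a); lia.
Qed.

Lemma third_ord3 (i k : 'I_3) : i != k -> exists j : 'I_3, i != j /\ j != k.
Proof.
by case: i => [[|[|[|]]]] // ?; case: k => [[|[|[|]]]] // ? // _;
 [exists (inord 2)|exists (inord 1)|exists (inord 2)|exists (inord 0)
 |exists (inord 1)|exists (inord 0)];
 rewrite -!(inj_eq val_inj) /= !inordK.
Qed.

Lemma min_degree_le (G : sgraph) (x : G) : min_degree G <= degree x.
Proof.
rewrite /min_degree; elim: (index_enum G) (mem_index_enum x) => // y l IH.
rewrite inE big_cons geq_min => /orP[/eqP->|/IH->]; first by rewrite leqnn.
by rewrite orbT.
Qed.

(** * Triangles forced by large minimum degree *)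

Section Tripartite.
Variables (G : sgraph) (V : 'I_3 -> {set G}).
Hypothesis tripV : tripartition V.

Definition ndeg (x : G) (i : 'I_3) : nat := #|[set y in V i | adj x y]|.

Definition triangle (x y z : G) : bool := [&& adj x y, adj x z & adj y z].

Lemma degree_ndeg (i j k : 'I_3) (x : G) :
  i != j -> j != k -> i != k -> x \in V i -> degree x <= ndeg x j + ndeg x k.
Proof.
case: tripV => cov _ ind ij jk ik xi; rewrite /degree /ndeg.
apply: leq_trans (leq_card_setU _ _); apply: subset_leq_card.
apply/subsetP => y; rewrite !inE => xy.
have : y \in \bigcup_a V a by rewrite cov inE.
case/bigcupP => a _ ya.
case/or3P: (ord3_cases a ij jk ik) => /eqP ea; rewrite ea in ya.
- by move: (ind _ _ _ xi ya); rewrite xy.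
- by rewrite ya xy.
- by rewrite ya xy orbT.
Qed.

Variable n : nat.
Hypothesis cardV : forall i, #|V i| = n.

(** Inside [V k] the neighbourhoods of [x] and [y] have a union of size at most [n], while
    [ndeg y i + ndeg y k >= n + t]; inclusion-exclusion cancels [n]. *)
Lemma codegree_ge (i j k : 'I_3) (t : nat) (x y : G) :
  i != j -> j != k -> i != k -> n + t <= min_degree G -> y \in V j ->
  ndeg x k + t <= #|[set z in V k | adj x z && adj y z]| + ndeg y i.
Proof.
move=> ij jk ik deg yj.
have := leq_trans deg (leq_trans (min_degree_le y)
  (degree_ndeg (i := j) (j := i) (k := k) _ ik jk yj)).
rewrite eq_sym => /(_ ij) dy.
have := cardsUI [set z in V k | adj x z] [set z in V k | adj y z].
rewrite -/(ndeg x k) -/(ndeg y k).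
have -> : [set z in V k | adj x z] :&: [set z in V k | adj y z]
        = [set z in V k | adj x z && adj y z].
  by apply/setP => z; rewrite !inE; case: (z \in V k).
have : #|[set z in V k | adj x z] :|: [set z in V k | adj y z]| <= n.
  rewrite -(cardV k); apply: subset_leq_card; apply/subsetP => z.
  by rewrite !inE => /orP[] /andP[].
lia.
Qed.

Lemma ndeg_ge (i j k : 'I_3) (t : nat) (x : G) :
  i != j -> j != k -> i != k -> n + t <= min_degree G -> x \in V i ->
  t <= ndeg x j.
Proof.
move=> ij jk ik deg xi.
have := leq_trans deg (leq_trans (min_degree_le x) (degree_ndeg ij jk ik xi)).
have : ndeg x k <= n.
  rewrite -(cardV k); apply: subset_leq_card; apply/subsetP => z.
  by rewrite inE => /andP[].
lia.
Qed.

(* Bollobás–Erdős–Szemerédi.  Among all [t]-subsets [T] of a class [V i] and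
   all other classes [V k], maximise the number of edges between [T] and [V k].
   The triangles through [T] already suffice: an edge [xy] from [T] to the third
   class lies in at least [t + ndeg x k - ndeg y i] triangles, and by maximality
   the differences sum up to something nonnegative when each [x] in [T] uses
   exactly [t] of its neighbours. *)
Lemma many_triangles (t : nat) : 0 < n -> n + t <= min_degree G ->
  exists i j k : 'I_3, [/\ i != j, j != k, i != k &
    t ^ 3 <= \sum_(x in V i) \sum_(y in V j) \sum_(z in V k) triangle x y z].
Proof.
move=> n0 deg.
have [x0 x0V] : exists x, x \in V ord0.
  by apply/card_gt0P; rewrite cardV.
(* Ensures that [V ord0] has a [t]-subset, so the maximum is over a nonempty family. *)
have le_tn : t <= n.
  have := @ndeg_ge ord0 (inord 1) (inord 2) t x0.
  rewrite -!(inj_eq val_inj) /= !inordK // => /(_ isT isT isT deg x0V) h.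
  apply: leq_trans h _; rewrite -(cardV (inord 1)); apply: subset_leq_card.
  by apply/subsetP => z; rewrite inE => /andP[].
pose P (q : {set G} * ('I_3 * 'I_3)) :=
  [&& q.1 \subset V q.2.1, #|q.1| == t & q.2.1 != q.2.2].
pose w (q : {set G} * ('I_3 * 'I_3)) := \sum_(x in q.1) ndeg x q.2.2.
have [T0 sT0 cT0] : exists2 S : {set G}, S \subset V ord0 & #|S| = t.
  by apply: subset_of_card; rewrite cardV.
have P0 : P (T0, (ord0, inord 1)).
  by rewrite /P /= sT0 cT0 eqxx -(inj_eq val_inj) /= inordK.
case: (@arg_maxnP _ _ P w P0) => -[T [i k]] /and3P[/= sT /eqP cT ik] maxT.
have [j [ij jk]] := third_ord3 ik.
exists i, j, k; split => //.
(* [set0] is a dummy value off [T], which makes the choice function total. *)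
have ex_S x : exists S : {set G},
    x \in T -> S \subset [set y in V j | adj x y] /\ #|S| = t.
  have [xT|_] := boolP (x \in T); last by exists set0.
  have [S sS cS] := subset_of_card (ndeg_ge ij jk ik deg (subsetP sT _ xT)).
  by exists S.
have {ex_S} [S SP] := fin_all_exists ex_S.
pose c x y := #|[set z in V k | adj x z && adj y z]|.
pose M := \sum_(x in T) ndeg x k.
have lower : t * M + t ^ 3
    <= \sum_(x in T) \sum_(y in S x) (c x y + ndeg y i).
  apply: (@leq_trans (\sum_(x in T) \sum_(y in S x) (ndeg x k + t))).
    rewrite (eq_bigr (fun x => t * ndeg x k + t * t)); last first.
      by move=> x /SP[_ cS]; rewrite sum_nat_const cS mulnDr.
    by rewrite big_split /= -big_distrr /= sum_nat_const cT !expnS expn0 muln1.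
  apply: leq_sum => x xT; apply: leq_sum => y yS.
  apply: codegree_ge ij jk ik deg _.
  by have [/subsetP/(_ _ yS)] := SP _ xT; rewrite inE => /andP[].
(* Each [S x] is a [t]-subset of [V j], so [(S x, (j, i))] competes with the maximiser and has
   weight at most [M]. *)
have upper : \sum_(x in T) \sum_(y in S x) ndeg y i <= t * M.
  rewrite -cT -sum_nat_const; apply: leq_sum => x xT.
  have [sS cS] := SP _ xT.
  apply: (maxT (S x, (j, i))); rewrite /P /= cS eqxx eq_sym ij !andbT.
  by apply: subset_trans sS _; apply/subsetP => z; rewrite inE => /andP[].
have count : \sum_(x in T) \sum_(y in S x) c x y
    <= \sum_(x in V i) \sum_(y in V j) \sum_(z in V k) triangle x y z.
  rewrite [X in _ <= X](big_setID T) /= (setIidPr sT).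
  apply: leq_trans (leq_addr _ _); apply: leq_sum => x xT.
  have [/subsetP sS _] := SP _ xT.
  have sSV : S x \subset V j.
    by apply/subsetP => y /sS; rewrite inE => /andP[].
  rewrite [X in _ <= X](big_setID (S x)) /= (setIidPr sSV).
  apply: leq_trans (leq_addr _ _); apply: leq_sum => y /sS.
  rewrite inE => /andP[_ xy]; rewrite sum_nat_mem_card /c /triangle xy.
  exact: leqnn.
apply: leq_trans count; move: lower.
under eq_bigr do rewrite big_split /=.
rewrite big_split /=; lia.
Qed.

(** * Copies of [K3 s], and the triangle bound in their absence *)

Lemma contains_K3 (s : nat) (S : 'I_3 -> {set G}) :
  (forall a, S a \subset V a) -> (forall a, #|S a| = s) ->
  (forall a b x y, a != b -> x \in S a -> y \in S b -> adj x y) ->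
  contains_copy G (K3 s).
Proof.
case: tripV => _ dis _ sS cS adjS.
pose f (u : K3 s) : G := enum_val (cast_ord (esym (cS u.1)) u.2).
have fS u : f u \in S u.1 by apply: enum_valP.
have fI : injective f.
  move=> [a u] [b v] fuv.
  have ab : a = b.
    apply/eqP/negPn/negP => /dis /disjoint_setI0/setP/(_ (f (a, u))).
    rewrite !inE (subsetP (sS a) _ (fS (a, u))).
    by rewrite fuv (subsetP (sS b) _ (fS (b, v))).
  by subst b; move/enum_val_inj/cast_ord_inj: fuv => /= ->.
exists (f @: [set: K3 s]).
(* The edges are exactly the images of edges of [K3 s], so injectivity of [f] reflects adjacency. *)
exists (fun x y => [exists u, exists v, [&& f u == x, f v == y & adj u v]]).
split; first split.
- move=> x y; apply/existsP/existsP => -[u /existsP[v /and3P[h1 h2 h3]]];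
  by exists v; apply/existsP; exists u; rewrite h1 h2 adj_sym.
- move=> x y /existsP[u /existsP[v /and3P[/eqP<- /eqP<- uv]]].
  by split; rewrite ?imset_f ?inE //; apply: adjS uv (fS u) (fS v).
- exists f; split=> // u v; apply/existsP/idP => [|uv].
    by case=> u' /existsP[v' /and3P[/eqP/fI-> /eqP/fI->]].
  by exists u; apply/existsP; exists v; rewrite !eqxx.
Qed.

Lemma contains_K3_of_cross_adj (s : nat) (i j k : 'I_3) (A B C : {set G}) :
  i != j -> j != k -> i != k ->
  A \subset V i -> B \subset V j -> C \subset V k ->
  #|A| = s -> #|B| = s -> #|C| = s ->
  {in A & B, forall x y, adj x y} -> {in A & C, forall x z, adj x z} ->
  {in B & C, forall y z, adj y z} ->
  contains_copy G (K3 s).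
Proof.
move=> ij jk ik sA sB sC cA cB cC AB AC BC.
pose S a := if a == i then A else if a == j then B else C.
apply: (@contains_K3 s S) => [a|a|a b x y]; rewrite /S.
- have := ord3_cases a ij jk ik.
  by case: eqP => [->|_] //; case: eqP => [->|_] //= /eqP->.
- by case: ifP => // _; case: ifP.
- move: (ord3_cases a ij jk ik) (ord3_cases b ij jk ik).
  case: (eqVneq a i) => [->|_]; case: (eqVneq b i) => [->|_] //=;
    rewrite ?eqxx //.
  + by move=> _ _ _ xA; case: ifP => _; [apply: AB|apply: AC].
  + move=> _ _ _ + yA; rewrite adj_sym.
    by case: ifP => _ xS; [apply: AB|apply: AC].
  case: (eqVneq a j) => [->|_]; case: (eqVneq b j) => [->|_] //=;
    rewrite ?eqxx //.
  + by move=> _ _ _; apply: BC.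
  + by move=> _ _ _ xC yB; rewrite adj_sym; apply: BC.
  by move=> /eqP-> /eqP->; rewrite eqxx.
Qed.

(* The bound obtained by applying the Kővári–Sós–Turán step first to [V i]
   against [V j * V k], then to the common link graph of an [s.+1]-subset of
   [V i], whose maximal number of edges is [m]. *)
Lemma triangles_bound_K3_free (s : nat) (i j k : 'I_3) :
  i != j -> j != k -> i != k -> ~ contains_copy G (K3 s.+1) ->
  exists m : nat,
    (m - n * s) ^ s.+1 <= n ^ s * (s * n ^ s.+1) /\
    (\sum_(x in V i) \sum_(y in V j) \sum_(z in V k) triangle x y z
       - n * n * s) ^ s.+1 <= (n * n) ^ s * (m * n ^ s.+1).
Proof.
move=> ij jk ik free.
pose L (S : {set G}) := [set p in setX (V j) (V k) |
  [forall x in S, triangle x p.1 p.2]].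
pose D (S : {set G}) := (S \subset V i) && (#|S| == s.+1).
pose m := \max_(S | D S) #|L S|.
exists m; split; last first.
  have -> : \sum_(x in V i) \sum_(y in V j) \sum_(z in V k) triangle x y z
    = \sum_(p in setX (V j) (V k)) \sum_(x in V i) triangle x p.1 p.2.
    rewrite [RHS]exchange_big; apply: eq_bigr => x _.
    by rewrite pair_big; apply: eq_bigl => -[y z]; rewrite in_setX.
  have -> : n * n = #|setX (V j) (V k)| by rewrite cardsX !cardV.
  rewrite -(cardV i).
  apply: (kovari_sos_turan_step (r := fun x p => triangle x p.1 p.2)) => S sS cS.
  by apply: (leq_bigmax_cond (F := fun S => #|L S|)); rewrite /D sS cS eqxx.
(* If [V i] has no [s.+1]-subset, the empty maximum gives [m = 0] and the left side vanishes. *)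
have [S DS|none] := pickP D; last by rewrite /m big_pred0 // exp0n.
have [S0 /andP[sS0 /eqP cS0] ->] :
  {S0 | D S0 & m = #|L S0|} by apply: eq_bigmax_cond; apply/card_gt0P; exists S.
pose r y z := [forall x in S0, triangle x y z].
have -> : #|L S0| = \sum_(z in V k) \sum_(y in V j) (r y z : nat).
  rewrite exchange_big pair_big /= -sum_nat_mem_card.
  by apply: eq_bigl => -[y z]; rewrite in_setX.
rewrite -{1 2}(cardV k) -(cardV j).
(* More than [s] common neighbours of [S1] in the link graph of [S0] would contain an [S2]
   completing [S0] and [S1] to a forbidden copy. *)
apply: kovari_sos_turan_step => S1 sS1 cS1; rewrite leqNgt; apply/negP => big_common.
have [S2 sS2 cS2] := subset_of_card big_common.
have inS2 z : z \in S2 -> z \in V k /\ {in S1, forall y, r y z}.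
  by move/(subsetP sS2); rewrite inE => /andP[? /forall_inP].
have tri x y z : x \in S0 -> y \in S1 -> z \in S2 -> triangle x y z.
  by move=> xS yS /inS2[_ /(_ _ yS)/forall_inP/(_ _ xS)].
have [x1 x1S] : exists x, x \in S0 by apply/card_gt0P; rewrite cS0.
have [z1 z1S] : exists z, z \in S2 by apply/card_gt0P; rewrite cS2.
have [y1 y1S] : exists y, y \in S1 by apply/card_gt0P; rewrite cS1.
apply: free; apply: (contains_K3_of_cross_adj ij jk ik sS0 sS1 _ cS0 cS1 cS2).
- by apply/subsetP => z /inS2[].
- by move=> x y xS yS; case/and3P: (tri _ _ _ xS yS z1S).
- by move=> x z xS zS; case/and3P: (tri _ _ _ xS y1S zS).
- by move=> y z yS zS; case/and3P: (tri _ _ _ x1S yS zS).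
Qed.

End Tripartite.

(** * Comparison of the bounds over the reals *)

Local Open Scope ring_scope.

(** Replaces the real exponents of the degree condition by an identity between integer powers. *)
Lemma powR_mean_expr (R : realType) (q : nat) (a b : R) :
  (0 < q)%N -> 0 <= a -> 0 <= b ->
  (a `^ (1 / q%:R) * b `^ (1 - 1 / q%:R)) ^+ q = a * b ^+ q.-1.
Proof.
move=> q0 a0 b0.
have qN0 : q%:R != 0 :> R by rewrite pnatr_eq0 -lt0n.
rewrite exprMn -!(powR_mulrn q) ?powR_ge0 // -!powRrM.
rewrite divfK // powRr1 // mulrBl !mul1r mulVf //.
by rewrite -(natrB R (n := 1)) // subn1 powR_mulrn.
Qed.

(** With [T = tau ^+ 3], [E] is at least [(1 + eps) ^+ 3 * T], and subtracting [n * n * p] still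
    leaves [(1 + eps) * T]. The bound on [E] then gives [m >= (1 + eps) * U], hence [m - n * p > U];
    but [U ^+ p.+1] equals the upper bound for [(m - n * p) ^ p.+1]. *)
Lemma K3_free_bounds_contradiction (R : realFieldType) (eps tau : R)
    (p n t E m : nat) :
  (0 < p)%N -> 0 < eps -> 0 <= tau ->
  tau ^+ (3 * p.+1 ^ 2) = p%:R * n%:R ^+ (3 * p.+1 ^ 2).-1 ->
  (p%:R / eps) ^+ (p.+1 ^ 2) < n%:R -> (p%:R / eps) ^+ p.+1 < n%:R ->
  (1 + eps) * tau <= t%:R -> (t ^ 3 <= E)%N ->
  ((m - n * p) ^ p.+1 <= n ^ p * (p * n ^ p.+1))%N ->
  ((E - n * n * p) ^ p.+1 <= (n * n) ^ p * (m * n ^ p.+1))%N -> False.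
Proof.
move=> p0 eps0 tau0 tauE Kn1 Kn2 tau_t tE mU EU.
have eps_ge0 := ltW eps0.
set K := p%:R / eps in Kn1 Kn2.
have K0 : 0 <= K by rewrite divr_ge0 // ltW.
have pK : p%:R = eps * K by rewrite /K mulrC divfK // gt_eqF.
clearbody K.
have p1 : 1 <= p%:R :> R by rewrite ler1n.
have n0 : 0 < n%:R :> R by apply: le_lt_trans Kn2; apply: exprn_ge0.
have n1 : 1 <= n%:R :> R by rewrite ler1n -(ltr0n R).
have nX0 q : 0 < n%:R ^+ q :> R by apply: exprn_gt0.
pose T := tau ^+ 3.
have T0 : 0 <= T by apply: exprn_ge0.
have TE : T ^+ (p.+1 ^ 2) = p%:R * n%:R ^+ (3 * p.+1 ^ 2).-1.
  by rewrite -exprM tauE.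
(* Since [p = eps * K], this says that [n * n * p] costs at most [eps * T]. Comparing powers needs
   [2 * p.+1 ^ 2 + 1 <= 3 * p.+1 ^ 2 - 1], true as [p > 0]. *)
have le_T : K * n%:R ^+ 2 <= T.
  rewrite -(@ler_pXn2r _ (p.+1 ^ 2)) ?nnegrE ?expn_gt0 ?mulr_ge0 //.
  rewrite TE exprMn -exprM.
  apply: (@le_trans _ _ (n%:R ^+ (2 * p.+1 ^ 2).+1)).
    by rewrite exprS ler_wpM2r // ltW.
  apply: (@le_trans _ _ (n%:R ^+ (3 * p.+1 ^ 2).-1)).
    by apply: ler_weXn2l => //; clear -p0; rewrite -mulnn; nia.
  by rewrite -[X in X <= _]mul1r ler_wpM2r // ltW.
have E_ge : (1 + eps) * T <= (E - n * n * p)%:R.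
  apply: (@le_trans _ _ (E%:R - (n * n * p)%:R)); last first.
    have [h|h] := leqP (n * n * p) E; first by rewrite natrB.
    by rewrite (@le_trans _ _ 0) // subr_le0 ler_nat ltnW.
  have h3 : ((1 + eps) * tau) ^+ 3 <= E%:R.
    apply: (@le_trans _ _ (t ^ 3)%:R); last by rewrite ler_nat.
    by rewrite natrX ler_pXn2r ?nnegrE ?mulr_ge0 ?addr_ge0.
  rewrite exprMn -/T in h3.
  have h4 : (n * n * p)%:R <= eps * T.
    by rewrite !natrM pK mulrCA -expr2 ler_pM2l // mulrC.
  have h5 : (1 + 2 * eps) * T <= (1 + eps) ^+ 3 * T.
    rewrite ler_wpM2r //; nra.
  lra.
(* The value of [m] giving equality in the bound on [E] when [E - n * n * p] is replaced by [T]. *)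
pose U := T ^+ p.+1 / n%:R ^+ (3 * p).+1.
have U0 : 0 <= U by rewrite divr_ge0 ?exprn_ge0 // ltW.
have UE : U ^+ p.+1 = p%:R * n%:R ^+ (2 * p).+1.
  rewrite /U expr_div_n -(exprM T) -(exprM n%:R) mulnn TE.
  apply: (canLR (mulfK _)); first by rewrite gt_eqF.
  rewrite -mulrA -exprD; congr (_ * _ ^+ _).
  by clear; rewrite -mulnn; lia.
have lt_U : K * n%:R < U.
  rewrite -(@ltr_pXn2r _ p.+1) ?nnegrE ?(mulr_ge0 K0) //.
  rewrite UE exprMn.
  apply: (@lt_le_trans _ _ (n%:R ^+ p.+2)).
    by rewrite (exprS _ p.+1) ltr_pM2r.
  apply: (@le_trans _ _ (n%:R ^+ (2 * p).+1)).
    by apply: ler_weXn2l => //; clear -p0; lia.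
  by rewrite -[X in X <= _]mul1r ler_wpM2r // ltW.
have m_ge : (1 + eps) * U <= m%:R.
  apply: (@le_trans _ _ ((1 + eps) ^+ p.+1 * U)).
    rewrite ler_wpM2r //; apply: ler_eXnr => //; lra.
  rewrite /U mulrA -exprMn ler_pdivrMr //.
  apply: (@le_trans _ _ ((E - n * n * p) ^ p.+1)%:R).
    by rewrite natrX ler_pXn2r ?nnegrE ?mulr_ge0 ?addr_ge0.
  have -> : m%:R * n%:R ^+ (3 * p).+1
      = ((n * n) ^ p * (m * n ^ p.+1))%:R :> R.
    rewrite !(natrM, natrX) -expr2 -exprM mulrCA -exprD.
    by congr (_ * _ ^+ _); clear; lia.
  by rewrite ler_nat.
have m_gt : U < (m - n * p)%:R.
  apply: (@lt_le_trans _ _ (m%:R - (n * p)%:R)).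
    have : (n * p)%:R < eps * U by rewrite natrM pK mulrCA ltr_pM2l // mulrC.
    lra.
  have [h|h] := leqP (n * p) m; first by rewrite natrB.
  by rewrite (@le_trans _ _ 0) // subr_le0 ler_nat ltnW.
have : U ^+ p.+1 < ((m - n * p) ^ p.+1)%:R by rewrite natrX ltr_pXn2r ?nnegrE.
rewrite UE ltNge; apply/negP/negPn.
have -> : p%:R * n%:R ^+ (2 * p).+1 = (n ^ p * (p * n ^ p.+1))%:R :> R.
  rewrite !(natrM, natrX) mulrCA -exprD.
  by congr (_ * _ ^+ _); clear; lia.
by rewrite ler_nat.
Qed.

Theorem theorem1p3 (R : realType) (s : nat) (eps : R) :
  (2 <= s)%N -> 0 < eps ->
  exists n0 : nat, forall n : nat, (n0 <= n)%N ->
    forall (G : sgraph) (V : 'I_3 -> {set G}),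
      tripartition V -> (forall i, #|V i| = n) ->
      n%:R + (1 + eps) * (s%:R - 1) `^ (1 / (3 * s%:R ^+ 2))
                       * n%:R `^ (1 - 1 / (3 * s%:R ^+ 2))
        <= (min_degree G)%:R ->
      contains_copy G (K3 s).
Proof.
case: s => [|p] // s2 eps0.
have p0 : (0 < p)%N by [].
pose K : R := p%:R / eps.
have K0 q : 0 <= K ^+ q by rewrite exprn_ge0 // divr_ge0 // ltW.
(* The sum of two nonnegative powers dominates both thresholds needed to absorb the subtracted
   terms. *)
exists (Num.bound (K ^+ (p.+1 ^ 2) + K ^+ p.+1)) => n le_n G V tripV cardV.
have Kn : K ^+ (p.+1 ^ 2) + K ^+ p.+1 < n%:R.
  apply: lt_le_trans (archi_boundP _) _; first exact: addr_ge0.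
  by rewrite ler_nat.
have Kn1 : K ^+ (p.+1 ^ 2) < n%:R by apply: le_lt_trans Kn; rewrite lerDl.
have Kn2 : K ^+ p.+1 < n%:R by apply: le_lt_trans Kn; rewrite lerDr.
have n0 : (0 < n)%N by rewrite -(ltr0n R); apply: le_lt_trans Kn2.
rewrite -[p.+1%:R - 1](_ : p%:R = _); last by rewrite -natr1 addrK.
have -> : 3 * p.+1%:R ^+ 2 = (3 * p.+1 ^ 2)%:R :> R by rewrite natrM natrX.
set q := (3 * p.+1 ^ 2)%N; rewrite -mulrA; set tau := _ * n%:R `^ _ => deg.
have tau0 : 0 <= tau by rewrite mulr_ge0 ?powR_ge0.
have tauE : tau ^+ q = p%:R * n%:R ^+ q.-1.
  by apply: powR_mean_expr => //; rewrite muln_gt0 expn_gt0.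
have eps_tau0 : 0 <= (1 + eps) * tau by rewrite mulr_ge0 // addr_ge0 // ltW.
have le_deg : (n <= min_degree G)%N.
  by rewrite -(ler_nat R); apply: le_trans deg; rewrite lerDl.
(* By [le_deg] this subtraction is exact, so no rounding of [(1 + eps) * tau] is involved. *)
pose t := (min_degree G - n)%N.
have tau_t : (1 + eps) * tau <= t%:R by rewrite natrB // lerBrDl.
have deg_t : (n + t <= min_degree G)%N by rewrite subnKC.
have [i [j [k [ij jk ik tE]]]] := many_triangles tripV cardV n0 deg_t.
have [//|free] := EM (contains_copy G (K3 p.+1)); exfalso.
have [m [mU EU]] := triangles_bound_K3_free tripV cardV ij jk ik free.
exact: (K3_free_bounds_contradiction p0 eps0 tau0 tauE Kn1 Kn2 tau_t tE mU EU).
Qed.
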